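(* Suppose that $A,B\in M_n(\mathbb C)$ and $D\in\mathbb C$ satisfies $D^2=n$. Then the following are equivalent: (i) $(A,B)$ is an invertible Jones pair. (ii) $(DA,\,nB^{-1},\,DA^{-1},\,B;\,D)$ is a four-weight spin model (this includes the requirement that $A^{-1}$ and $B^{-1}$ exist).
   Context: $\circ$ denotes the entrywise (Schur) product, $J$ the all-ones matrix, and $C^{(-)}$ the Schur inverse of a matrix $C$ with no zero entries ($C\circ C^{(-)}=J$). For $C\in M_n(\mathbb C)$ define endomorphisms of $M_n(\mathbb C)$ by $X_C(M)=CM$ and $\Delta_C(M)=C\circ M$. $(A,B)$ is a one-sided Jones pair if $X_A$ and $\Delta_B$ are invertible (i.e. $A^{-1}$ and $B^{(-)}$ exist) and $X_A\Delta_BX_A=\Delta_BX_A\Delta_B$. $(A,B)$ is a Jones pair if both $(A,B)$ and $(A,B^T)$ are one-sided Jones pairs; it is invertible if in addition $A^{(-)}$ and $B^{-1}$ both exist. A four-weight spin model is a 5-tuple $(W_1,W_2,W_3,W_4;D)$ where $W_1,W_2,W_3,W_4$ are $n\times n$ complex matrices and $D$ is a square root of $n$ such that $W_1\circ W_3^T=J$, $W_2\circ W_4^T=J$, $W_1W_3=nI$, $W_2W_4=nI$, and for all $i,j,k\in\{1,\dots,n\}$ $$\sum_{h=1}^n(W_1)_{k,h}(W_1)_{h,i}(W_4)_{h,j}=D(W_4)_{i,j}(W_1)_{k,i}(W_4)_{k,j},$$ $$\sum_{h=1}^n(W_1)_{h,k}(W_1)_{i,h}(W_4)_{j,h}=D(W_4)_{j,i}(W_1)_{i,k}(W_4)_{j,k}.$$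 *)

(* Defs.v *)
From HB Require Import structures.
From mathcomp Require Import all_boot all_order all_algebra.
From mathcomp Require Import reals complex.

Set Implicit Arguments.
Unset Strict Implicit.
Unset Printing Implicit Defensive.

Import GRing.Theory.
Local Open Scope ring_scope.

Definition schur_mul (K : fieldType) (n : nat) (C M : 'M[K]_n) : 'M[K]_n :=
  map2_mx *%R C M.

Notation "C ∘ M" := (schur_mul C M) (at level 40, left associativity)
  : ring_scope.

Definition J_mx (K : fieldType) (n : nat) : 'M[K]_n := const_mx 1.

Definition schur_unit (K : fieldType) (n : nat) (C : 'M[K]_n) : Prop :=
  forall i j, C i j != 0.

Definition schur_inv (K : fieldType) (n : nat) (C : 'M[K]_n) : 'M[K]_n :=
  map_mx GRing.inv C.

Lemma schur_mulV (K : fieldType) (n : nat) (C : 'M[K]_n) :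
  schur_unit C -> C ∘ schur_inv C = J_mx K n.
Proof. by move=> uC; apply/matrixP=> i j; rewrite !mxE mulfV. Qed.

Lemma schur_unitP (K : fieldType) (n : nat) (C : 'M[K]_n) :
  schur_unit C <-> exists M, C ∘ M = J_mx K n.
Proof.
split=> [uC | [M /matrixP CM] i j]; first by exists (schur_inv C); exact: schur_mulV.
apply/eqP=> Cij0; have := CM i j; rewrite !mxE Cij0 mul0r => /esym/eqP.
by rewrite oner_eq0.
Qed.

Definition X_ (K : fieldType) (n : nat) (C M : 'M[K]_n) : 'M[K]_n := C *m M.

Definition Delta_ (K : fieldType) (n : nat) (C M : 'M[K]_n) : 'M[K]_n := C ∘ M.

Fact X_is_linear (K : fieldType) (n : nat) (C : 'M[K]_n) : linear (X_ C).
Proof. by move=> a M N; rewrite /X_ mulmxDr scalemxAr. Qed.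

HB.instance Definition _ (K : fieldType) (n : nat) (C : 'M[K]_n) :=
  GRing.isLinear.Build K 'M[K]_n 'M[K]_n _ (X_ C) (X_is_linear C).

Fact Delta_is_linear (K : fieldType) (n : nat) (C : 'M[K]_n) :
  linear (Delta_ C).
Proof. by move=> a M N; apply/matrixP=> i j; rewrite !mxE mulrDr mulrCA. Qed.

HB.instance Definition _ (K : fieldType) (n : nat) (C : 'M[K]_n) :=
  GRing.isLinear.Build K 'M[K]_n 'M[K]_n _ (Delta_ C) (Delta_is_linear C).

Lemma X_bijP (K : fieldType) (n : nat) (C : 'M[K]_n) :
  bijective (X_ C) <-> C \in unitmx.
Proof.
split=> [[g _ gK] | uC]; first by have /mulmx1_unit[] := gK 1%:M.
exists (X_ (invmx C)) => M; first exact: mulKmx.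
exact: mulKVmx.
Qed.

Lemma Delta_bijP (K : fieldType) (n : nat) (C : 'M[K]_n) :
  bijective (Delta_ C) <-> schur_unit C.
Proof.
split=> [[g _ gK] | uC].
  by apply/schur_unitP; exists (g (J_mx K n)); exact: gK.
exists (Delta_ (schur_inv C)) => M; apply/matrixP=> i j; rewrite !mxE.
  by rewrite mulKf.
by rewrite mulVKf.
Qed.

Definition one_sided_Jones_pair (K : fieldType) (n : nat) (A B : 'M[K]_n)
    : Prop :=
  [/\ bijective (X_ A), bijective (Delta_ B)
    & X_ A \o Delta_ B \o X_ A =1 Delta_ B \o X_ A \o Delta_ B].

Definition Jones_pair (K : fieldType) (n : nat) (A B : 'M[K]_n) : Prop :=
  one_sided_Jones_pair A B /\ one_sided_Jones_pair A B^T.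

Definition invertible_Jones_pair (K : fieldType) (n : nat) (A B : 'M[K]_n)
    : Prop :=
  [/\ Jones_pair A B, schur_unit A & B \in unitmx].

Record four_weight_spin_model (K : fieldType) (n : nat)
    (W1 W2 W3 W4 : 'M[K]_n) (D : K) : Prop := FourWeightSpinModel {
  fwsm_sqr : D ^+ 2 = n%:R;
  fwsm_schur13 : W1 ∘ W3^T = J_mx K n;
  fwsm_schur24 : W2 ∘ W4^T = J_mx K n;
  fwsm_mul13 : W1 *m W3 = n%:R *: 1%:M;
  fwsm_mul24 : W2 *m W4 = n%:R *: 1%:M;
  fwsm_star1 : forall i j k : 'I_n,
    \sum_(h < n) W1 k h * W1 h i * W4 h j = D * W4 i j * W1 k i * W4 k j;
  fwsm_star2 : forall i j k : 'I_n,
    \sum_(h < n) W1 h k * W1 i h * W4 j h = D * W4 j i * W1 i k * W4 j k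
}.

(* Main.v *)
Require Import Defs.
From mathcomp Require Import all_boot all_order all_algebra.
From mathcomp Require Import reals complex.
From mathcomp Require Import ring.

Import GRing.Theory.
Local Open Scope ring_scope.
Local Open Scope complex_scope.

(* Evaluated at matrix units, the braid relations of [(A, B)] and [(A, B^T)]
   are exactly the two star identities, so everything rests on showing that in
   an invertible Jones pair both A and B are type II matrices.  Let b_k be the
   k-th row of B and U_k the diagonal matrix of the k-th row of A.  The braid
   relation reads A^T (U_k B) = (U_k B) diag(b_k); hence diag(b_k) is similar to
   A^T and every row of B sums to t = tr A.  Inverting it gives
   sum_h (A^-1)_hi A_kh B_hj = A_ki B_ij / B_kj.  Summing over j, the left side
   becomes t delta_ki, so B is type II and n A_ii = t.  Taking k = i instead,
   the vector (A_ih (A^-1)_hi)_h is mapped by B to the constant A_ii; the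
   columns of B also sum to t, because (A, B^T) is a Jones pair too, so this
   vector is constant and A is type II. *)

Section JonesPairs.
Set Implicit Arguments.
Unset Strict Implicit.
Context {K : fieldType} {n : nat}.
Implicit Types A B : 'M[K]_n.

Lemma braidP A B :
  X_ A \o Delta_ B \o X_ A =1 Delta_ B \o X_ A \o Delta_ B <->
  forall i j k, \sum_h A k h * A h i * B h j = B i j * A k i * B k j.
Proof.
split=> [braid i j k | star M].
  have /matrixP/(_ k j) := braid (delta_mx i j).
  rewrite /= /X_ /Delta_ !mxE => eq_kj.
  transitivity (\sum_h A k h * (B ∘ (A *m delta_mx i j)) h j).
    apply: eq_bigr => h _; rewrite !mxE (bigD1 i) //= big1 => [|l neq_li].
      by rewrite mxE !eqxx mulr1 addr0 mulrAC mulrA.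
    by rewrite mxE (negPf neq_li) mulr0.
  rewrite eq_kj (bigD1 i) //= big1 => [|l neq_li].
    by rewrite !mxE !eqxx mulr1 addr0 mulrC (mulrC (A k i)).
  by rewrite !mxE (negPf neq_li) !mulr0.
(* For arbitrary [M], the coefficients of each [M i j] in the entry at [k], [j] agree by [star]. *)
apply/matrixP=> k j; rewrite /= /X_ /Delta_ !mxE mulr_sumr.
under eq_bigr => h _ do rewrite !mxE !mulr_sumr.
rewrite exchange_big /=; apply: eq_bigr => i _; rewrite !mxE.
transitivity ((\sum_h A k h * A h i * B h j) * M i j).
  by rewrite mulr_suml; apply: eq_bigr => h _; ring.
by rewrite star; ring.
Qed.

Section OneSided.
Variables A B : 'M[K]_n.
Hypotheses (uA : A \in unitmx) (uB : B \in unitmx).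
Hypotheses (sA : schur_unit A) (sB : schur_unit B).
Hypothesis braid : X_ A \o Delta_ B \o X_ A =1 Delta_ B \o X_ A \o Delta_ B.

Lemma braid_eigen k :
  A^T *m (diag_mx (row k A) *m B) =
  diag_mx (row k A) *m B *m diag_mx (row k B).
Proof.
apply/matrixP=> i j; rewrite mul_mx_diag mul_diag_mx !mxE.
under eq_bigr => h _ do rewrite !mxE mulrA (mulrC (A h i)).
by rewrite (proj1 (braidP A B) braid) (mulrC (B i j)).
Qed.

Lemma braid_row_sum k : \sum_j B k j = \tr A.
Proof.
(* No entry of [A] vanishes, so the diagonal factor is invertible and [braid_eigen] becomes a
   similarity. *)
have uV : diag_mx (row k A) *m B \in unitmx.
  rewrite unitmx_mul uB andbT unitmxE det_diag unitfE.
  by apply/prodf_neq0 => i _; rewrite mxE.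
transitivity (\tr (diag_mx (row k B))).
  by rewrite mxtrace_diag; apply: eq_bigr => j _; rewrite mxE.
by rewrite -[diag_mx _](mulKmx uV) -braid_eigen mxtrace_mulC mulmxK // mxtrace_tr.
Qed.

Lemma braid_inverse i j k :
  \sum_h invmx A h i * A k h * B h j = A k i * (B i j / B k j).
Proof.
have uAT : A^T \in unitmx by rewrite unitmx_tr.
have := congr1 (mulmx (invmx A^T)) (braid_eigen k).
rewrite mulKmx // mulmxA => /matrixP/(_ i j).
rewrite mul_mx_diag mul_diag_mx -trmx_inv !mxE => eq_ij.
rewrite mulrA eq_ij mulfK //.
by apply: eq_bigr => h _; rewrite !mxE mulrA.
Qed.

Lemma braid_ratio_sum i k :
  A k i * (\sum_j B i j / B k j) = \tr A * (k == i)%:R.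
Proof.
rewrite mulr_sumr; under eq_bigr => j _ do rewrite -braid_inverse.
rewrite exchange_big /=.
(* The constant row sums of [B] factor out, leaving an entry of [A *m invmx A]. *)
under eq_bigr => h _ do rewrite -mulr_sumr braid_row_sum.
rewrite -mulr_suml mulrC; congr (_ * _).
have /matrixP/(_ k i) := mulmxV uA; rewrite !mxE => <-.
by apply: eq_bigr => h _; rewrite mulrC.
Qed.

Lemma braid_diag i : A i i * n%:R = \tr A.
Proof.
transitivity (A i i * \sum_j B i j / B i j).
  rewrite (eq_bigr (fun=> 1)) => [|j _]; last by rewrite divff.
  by rewrite sumr_const card_ord.
by rewrite braid_ratio_sum eqxx mulr1.
Qed.

Lemma braid_type2 : B *m (schur_inv B)^T = n%:R%:M.
Proof.
apply/matrixP=> i k; rewrite !mxE.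
transitivity (\sum_j B i j / B k j); first by apply: eq_bigr => j _; rewrite !mxE.
apply: (mulfI (sA k i)); rewrite braid_ratio_sum eq_sym.
by case: eqP => [->|_]; rewrite ?mulr0 // mulr1 mulr1n braid_diag.
Qed.

End OneSided.

Lemma invertible_Jones_pair_type2_r A B :
  invertible_Jones_pair A B -> (n%:R *: invmx B) ∘ B^T = J_mx K n.
Proof.
case=> -[[/X_bijP uA /Delta_bijP sB braid] _] sA uB.
have -> : n%:R *: invmx B = (schur_inv B)^T.
  by rewrite -[RHS](mulKmx uB) (braid_type2 uA uB sA sB braid) mul_mx_scalar.
by apply/matrixP=> i j; rewrite !mxE mulVf.
Qed.

Lemma invertible_Jones_pair_type2_l A B :
  invertible_Jones_pair A B ->
  forall i j, n%:R * (A i j * invmx A j i) = 1.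
Proof.
case=> -[[/X_bijP uA /Delta_bijP sB braid] [_ /Delta_bijP sBT braidT]] sA uB i j.
have uBT : B^T \in unitmx by rewrite unitmx_tr.
pose v : 'rV[K]_n := \row_h (n%:R * (A i h * invmx A h i)).
suff /rowP/(_ j) : v = const_mx 1 by rewrite !mxE.
(* As [B] is invertible, it suffices that [v] and the all-ones row have the same product with [B]:
   both give the constant row [\tr A]. *)
apply: (can_inj (mulmxK uB)); apply/rowP=> l; rewrite !mxE.
transitivity (n%:R * \sum_h invmx A h i * A i h * B h l).
  by rewrite mulr_sumr; apply: eq_bigr => h _; rewrite !mxE (mulrC (A i h)) mulrA.
rewrite braid_inverse // divff // mulr1 mulrC (braid_diag uA uB sA sB braid).
rewrite -(braid_row_sum uBT sA braidT l).
by apply: eq_bigr => h _; rewrite !mxE mul1r.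
Qed.

End JonesPairs.

(* [invmx M] is [M] itself when [M] is singular, so the existence of the two
   inverses is asserted separately. *)
Theorem theorem9p1 (R : realType) (n : nat) (n_gt0 : (0 < n)%N)
    (A B : 'M[R[i]]_n) (D : R[i]) (D_sqr : D ^+ 2 = n%:R) :
  invertible_Jones_pair A B <->
  [/\ A \in unitmx, B \in unitmx
    & four_weight_spin_model (D *: A) (n%:R *: invmx B) (D *: invmx A) B D].
Proof.
(* Positive [n] and characteristic zero allow the scaling by [D] to be undone. *)
have D2_neq0 : D * D != 0 by rewrite -expr2 D_sqr Num.Theory.pnatr_eq0 -lt0n.
have scale_sum (F G H : 'I_n -> R[i]) :
    \sum_h (D * F h) * (D * G h) * H h = D * D * \sum_h F h * G h * H h.
  by rewrite mulr_sumr; apply: eq_bigr => h _; ring.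
split=> [JAB | [uA uB W]].
  have := JAB.
  case=> -[[/X_bijP uA _ /braidP star] [_ _ /braidP starT]] _ uB.
  split=> //; split=> //.
  - apply/matrixP=> i j; rewrite !mxE mulrACA -expr2 D_sqr.
    exact: (invertible_Jones_pair_type2_l JAB).
  - exact: (invertible_Jones_pair_type2_r JAB).
  - by rewrite -scalemxAl -scalemxAr mulmxV // scalerA -expr2 D_sqr.
  - by rewrite -scalemxAl mulVmx.
  - move=> i j k; under eq_bigr => h _ do rewrite !mxE.
    by rewrite mxE scale_sum star; ring.
  (* The second star identity is the relation for [B^T] with [i] and [k] exchanged. *)
  - move=> i j k; have := congr1 ( *%R (D * D)) (starT k j i).
    rewrite -scale_sum !mxE => eq_ijk.
    transitivity (D * D * (B j k * A i k * B j i)); last by ring.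
    by rewrite -eq_ijk; apply: eq_bigr => h _; rewrite !mxE; ring.
case: W => _ W13 W24 _ _ star star2.
(* A zero entry would give a zero in a Schur product equal to [J_mx]. *)
have sA : schur_unit A.
  move=> i j; apply/eqP=> Aij0; have /matrixP/(_ i j)/eqP := W13.
  by rewrite !mxE Aij0 mulr0 mul0r eq_sym oner_eq0.
have sBT : schur_unit B^T.
  move=> i j; rewrite mxE; apply/eqP=> Bji0; have /matrixP/(_ i j)/eqP := W24.
  by rewrite !mxE Bji0 mulr0 eq_sym oner_eq0.
have sB : schur_unit B by move=> i j; have := sBT j i; rewrite mxE.
split=> //; split; split; try exact/X_bijP; try exact/Delta_bijP.
  apply/braidP=> i j k; apply: (mulfI D2_neq0); rewrite -scale_sum.
  transitivity (D * B i j * (D *: A) k i * B k j); last by rewrite mxE; ring.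
  by rewrite -star; apply: eq_bigr => h _; rewrite !mxE.
apply/braidP=> i j k; apply: (mulfI D2_neq0); rewrite -scale_sum !mxE.
transitivity (D * B j k * (D *: A) k i * B j i); last by rewrite mxE; ring.
by rewrite -star2; apply: eq_bigr => h _; rewrite !mxE; ring.
Qed.
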